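(* Let $\{\mu_n\}_{n\geqslant0}$ be a sequence of real numbers such that $\det G_n\neq0$ for all $n\geqslant0$, where $G_n=[\mu_{i+j}]_{i,j=0}^n$. For $n\geqslant0$, let $S_n^{-1}\,H_n\,S_n^{-\top}$ be the Cholesky factorization of $G_n$ and let $\bar s_{n,0},\bar s_{n,1},\dots,\bar s_{n,n}$ denote the columns of $S_n^{\top}$. Then $\{\mu_n\}_{n\geqslant0}$ is classical if and only if there are $a,b,c\in\mathbb{R}$ such that $|a|+|b|+|c|>0$, and nonzero real numbers $\varpi_k$, $k\geqslant1$, such that $$N_{n+k}^{\top}\cdots N_{n+1}^{\top}\,G_n^{(k)}\,\bar s_{n,0}=\varpi_k\,G_{n+k}\,\bar s_{n+k,k},\quad n\geqslant1,\quad 1\leqslant k\leqslant n,$$ where $G_n^{(k)}=[\sigma_{i+j}^{(k)}]_{i,j=0}^n$, with $\sigma_n^{(0)}=\mu_n$ and $\sigma_n^{(k)}=a\,\sigma_{n+2}^{(k-1)}+b\,\sigma_{n+1}^{(k-1)}+c\,\sigma_n^{(k-1)}$ for $n\geqslant0$, $k\geqslant1$.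
   Context: A sequence of real numbers $\{\mu_n\}_{n\geqslant 0}$ with $\mu_0\neq0$ is pre-classical if there are real numbers $a,b,c,d,e$ with $|a|+|b|+|c|>0$ and $n\,a+d\neq0$ for all $n\geqslant0$, such that $(n\,a+d)\,\mu_{n+1}+(n\,b+e)\,\mu_n+n\,c\,\mu_{n-1}=0$ for all $n\geqslant0$ (with $\mu_n=0$ for $n<0$). It is classical if moreover $\det G_n\neq0$ for all $n\geqslant0$. The Cholesky factorization $G_n=S_n^{-1}H_nS_n^{-\top}$ is the unique one with $S_n$ (equivalently $S_n^{-1}$) unit lower triangular and $H_n$ nonsingular diagonal; $S_n^{-\top}=(S_n^{-1})^{\top}$. $N_{n}$, $n\geqslant 1$, is the $n\times(n+1)$ matrix (rows and columns indexed from $0$) with $(N_n)_{k,k+1}=k+1$ for $0\leqslant k\leqslant n-1$ and zeros elsewhere. The product $N_{n+k}^{\top}\cdots N_{n+1}^{\top}$ is taken with decreasing indices from left to right. *)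

(* Defs.v *)
From HB Require Import structures.
From mathcomp Require Import all_boot all_order all_algebra.
From mathcomp Require Import reals.

Set Implicit Arguments.
Unset Strict Implicit.
Unset Printing Implicit Defensive.

Import Order.TTheory GRing.Theory Num.Theory.
Local Open Scope ring_scope.

Definition hankel (R : realType) (mu : nat -> R) (n : nat) : 'M[R]_n.+1 :=
  \matrix_(i, j) mu (i + j)%N.

(* The value of the sequence at n - 1, with mu_(-1) = 0. *)
Definition prev (R : realType) (mu : nat -> R) (n : nat) : R :=
  if n is m.+1 then mu m else 0.

Definition pre_classical (R : realType) (mu : nat -> R) : Prop :=
  mu 0%N != 0 /\
  exists a b c d e : R,
    [/\ 0 < `|a| + `|b| + `|c|,
        (forall n : nat, n%:R * a + d != 0)
      & (forall n : nat,
          (n%:R * a + d) * mu n.+1 + (n%:R * b + e) * mu n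
            + n%:R * c * prev mu n = 0)].

Definition classical (R : realType) (mu : nat -> R) : Prop :=
  pre_classical mu /\ forall n : nat, \det (hankel mu n) != 0.

(* is_trig_mx is lower triangularity: entries (i, j) with i < j vanish. *)
Definition unit_lower_triangular (R : realType) (n : nat) (A : 'M[R]_n) : Prop :=
  is_trig_mx A /\ forall i, A i i = 1.

(* G = S^-1 H S^-T. *)
Definition cholesky (R : realType) (n : nat) (G S H : 'M[R]_n) : Prop :=
  [/\ unit_lower_triangular S, is_diag_mx H, H \in unitmx
    & G = invmx S *m H *m (invmx S)^T].

Definition Nmx (R : realType) (n : nat) : 'M[R]_(n, n.+1) :=
  \matrix_(i, j) if (j == i.+1 :> nat) then (i.+1)%:R else 0.

(* N_(n+k)^T *m ... *m N_(n+1)^T; the height is written (k + n).+1 so that the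
   dimensions of the factors match by conversion. *)
Fixpoint NTprod (R : realType) (n k : nat) : 'M[R]_((k + n).+1, n.+1) :=
  if k is k'.+1 then (Nmx R (k' + n).+1)^T *m NTprod R n k' else 1%:M.

Fixpoint sigma (R : realType) (a b c : R) (mu : nat -> R) (k n : nat) : R :=
  if k is k'.+1 then
    a * sigma a b c mu k' n.+2 + b * sigma a b c mu k' n.+1
      + c * sigma a b c mu k' n
  else mu n.

(* Main.v *)
Require Import Defs.
From HB Require Import structures.
From mathcomp Require Import all_boot all_order all_algebra.
From mathcomp Require Import reals.
From mathcomp Require Import ring zify.

Set Implicit Arguments.
Unset Strict Implicit.
Unset Printing Implicit Defensive.

Import Order.TTheory GRing.Theory Num.Theory.
Local Open Scope ring_scope.

(** Let [u] be the linear functional on polynomials with moments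
    [<u, X^n> = mu n], and write [phi = a X^2 + b X + c], [psi = d X + e].  The
    statement is the equivalence between the Pearson equation and the Rodrigues
    formula, in matrix form.

    The recurrence defining a pre-classical sequence says that
    [<u, phi p' + psi p> = 0] for every polynomial [p], that is
    [D(phi u) = psi u].  Row [k] of [S n] lists the coefficients of the monic
    orthogonal polynomial [P_k] of [u] ([chol_poly_orthogonal]); in particular
    the column of index [0] of [(S n)^T] is a unit vector.  As
    [sigma^(k)_n = <u, phi^k X^n>] and the product of the matrices [N^T]
    differentiates [k] times, entry [j] of the matrix identity is
    [<u, phi^k D^k X^j> = varpi_k <u, P_k X^j>] ([matrix_identityP]).

    The Pearson equation allows [k] integrations by parts, which give
    [<u, phi^k D^k p> = (-1)^k <u, Q_k p>] with an explicit [Q_k] of degree at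
    most [k] ([rodriguesE]) whose coefficient of degree [k], called its leading
    coefficient below, is a product of factors [i a + d], the factor with
    [i = k - 1] being among them ([rodrigues_coef]).

    If [mu] is classical, all these factors are nonzero.  In general [Q_k] is
    orthogonal to all polynomials of degree less than [k], because their [k]-th
    derivative vanishes; hence it is its leading coefficient times [P_k], which
    gives the Rodrigues formula ([rodrigues_formula]).  Conversely, the identity
    for [k = 1] is the Pearson equation with [psi = - varpi_1 P_1]; comparing
    the identity for [k], tested on [X^k], with [rodrigues_formula] shows that
    the leading coefficient is [(-1)^k varpi_k], because
    [<u, P_k X^k> != 0] ([monic_orthogonal_neq0]).  It is thus nonzero, and so
    is its factor [(k - 1) a + d]. *)

(** * The moment functional *)

(** The linear functional [u] with moments [mu], [X^n |-> mu n]. *)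
Definition moment (R : realType) (mu : nat -> R) (p : {poly R}) : R :=
  \sum_(i < size p) p`_i * mu i.

Section Moment.
Variables (R : realType) (mu : nat -> R).
Local Notation L := (moment mu).

Lemma moment_wide (n : nat) (p : {poly R}) :
  (size p <= n)%N -> L p = \sum_(i < n) p`_i * mu i.
Proof.
move=> le_pn; rewrite /moment (big_ord_widen n (fun i => p`_i * mu i)) //.
rewrite big_mkcond; apply: eq_bigr => i _.
by case: ltnP => // le_pi; rewrite nth_default // mul0r.
Qed.

Lemma moment_is_scalar : scalar L.
Proof.
move=> c p q; set n := maxn (size p) (size q).
have sp : (size p <= n)%N by rewrite leq_maxl.
have sq : (size q <= n)%N by rewrite leq_maxr.
have spq : (size (c *: p + q)%R <= n)%N.
  rewrite (leq_trans (size_polyD _ _)) // geq_max sq andbT.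
  exact: leq_trans (size_scale_leq _ _) sp.
rewrite !(@moment_wide n) // mulr_sumr -big_split /=.
by apply: eq_bigr => i _; rewrite coefD coefZ mulrDl mulrA.
Qed.

HB.instance Definition _ :=
  GRing.isLinear.Build R {poly R} R *%R L moment_is_scalar.

Lemma momentZ (c : R) (p : {poly R}) : L (c *: p) = c * L p.
Proof. exact: linearZ. Qed.

Lemma momentXn (n : nat) : L 'X^n = mu n.
Proof.
rewrite /moment size_polyXn big_ord_recr /= coefXn eqxx mul1r big1 ?add0r //.
by move=> i _; rewrite coefXn ltn_eqF ?mul0r.
Qed.

(** A linear identity in [p] may be checked on monomials. *)
Lemma moment_eq_on_monomials (f : {linear {poly R} -> {poly R}}) :
  (forall n, L (f 'X^n) = 0) -> forall p, L (f p) = 0.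
Proof.
move=> f0 p; rewrite -[p]coefK poly_def !linear_sum big1 // => i _.
by rewrite !linearZ /= f0 mulr0.
Qed.

Lemma moment_mulXn (p : {poly R}) (n j : nat) :
  (size p <= n)%N -> L (p * 'X^j) = \sum_(i < n) p`_i * mu (j + i)%N.
Proof.
move=> le_pn; rewrite -{1}[p]coefK poly_def mulr_suml linear_sum /=.
rewrite (big_ord_widen n (fun i => L (p`_i *: 'X^i * 'X^j))) // big_mkcond.
apply: eq_bigr => i _; rewrite -scalerAl -exprD momentZ momentXn addnC.
by case: ltnP => // le_pi; rewrite nth_default // mul0r.
Qed.

(** * Regularity and orthogonal polynomials *)

Section Regular.
Hypothesis hdet : forall n : nat, \det (hankel mu n) != 0.

(** If [u] is regular, no nonzero polynomial of degree less than [n] is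
    orthogonal to all polynomials of degree less than [n]. *)
Lemma moment_regular (n : nat) (p : {poly R}) :
    (size p <= n)%N -> (forall j, (j < n)%N -> L (p * 'X^j) = 0) -> p = 0.
Proof.
case: n => [|n] le_pn Lp0; first by apply/eqP; rewrite -size_poly_leq0.
pose v := poly_rV p : 'rV[R]_n.+1.
have v0 : v *m hankel mu n = 0.
  apply/rowP => j; rewrite !mxE -[RHS](Lp0 j) // (moment_mulXn _ le_pn).
  by apply: eq_bigr => i _; rewrite !mxE addnC.
rewrite -(poly_rV_K le_pn) -/v.
have hU : hankel mu n \in unitmx by rewrite unitmxE unitfE.
by rewrite -(mulmxK hU v) v0 mul0mx linear0.
Qed.

(** [p] is the monic orthogonal polynomial of degree [k]. *)
Definition monic_orthogonal (k : nat) (p : {poly R}) : Prop :=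
  [/\ (size p <= k.+1)%N, p`_k = 1
    & forall j, (j < k)%N -> L (p * 'X^j) = 0].

Lemma size_polyB_coef (k : nat) (p q : {poly R}) :
  (size p <= k.+1)%N -> (size q <= k.+1)%N -> p`_k = q`_k ->
  (size (p - q)%R <= k)%N.
Proof.
move=> sp sq epq; apply/leq_sizeP => j; rewrite leq_eqVlt => /predU1P[<-|ltkj].
  by rewrite coefB epq subrr.
by rewrite coefB !nth_default ?subrr // (leq_trans _ ltkj).
Qed.

(** An orthogonal polynomial of degree at most [k] is a multiple of the monic
    one, possibly zero. *)
Lemma orthogonal_scale (k : nat) (p q : {poly R}) :
  monic_orthogonal k p -> (size q <= k.+1)%N ->
  (forall j, (j < k)%N -> L (q * 'X^j) = 0) -> q = q`_k *: p.
Proof.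
move=> [sp pk op] sq oq; apply/subr0_eq/(@moment_regular k).
  apply: size_polyB_coef => //; first exact: leq_trans (size_scale_leq _ _) sp.
  by rewrite coefZ pk mulr1.
move=> j ltjk; rewrite mulrBl -scalerAl linearB /= momentZ.
by rewrite oq // op // mulr0 subrr.
Qed.

Lemma monic_orthogonal_uniq (k : nat) (p q : {poly R}) :
  monic_orthogonal k p -> monic_orthogonal k q -> p = q.
Proof.
by move=> hp [sq qk oq]; rewrite [q](orthogonal_scale hp sq oq) qk scale1r.
Qed.

Lemma monic_orthogonal_neq0 (k : nat) (p : {poly R}) :
  monic_orthogonal k p -> L (p * 'X^k) != 0.
Proof.
move=> [sp pk op]; apply/eqP => Lpk.
have p0 : p = 0.
  apply: (moment_regular sp) => j.
  by rewrite ltnS leq_eqVlt => /predU1P[->|/op].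
by move/eqP: pk; rewrite p0 coef0 eq_sym oner_eq0.
Qed.

End Regular.

(** * The Pearson equation and iterated integration by parts *)

Section Pearson.
Variables (a b c d e : R).

(** The coefficients [phi] and [psi] of the Pearson equation. *)
Definition phi : {poly R} := a *: 'X^2 + b *: 'X + c%:P.
Definition psi : {poly R} := d *: 'X + e%:P.

(** The Pearson equation [D(phi u) = psi u], tested against polynomials. *)
Definition pearson : Prop := forall p, L (phi * p^`() + psi * p) = 0.

Lemma pearson_monomial (n : nat) :
  L (phi * ('X^n)^`() + psi * 'X^n)
  = (n%:R * a + d) * mu n.+1 + (n%:R * b + e) * mu n
    + n%:R * c * Defs.prev mu n.
Proof.
have -> : phi * ('X^n)^`() + psi * 'X^n = (n%:R * a + d) *: 'X^(n.+1)
    + (n%:R * b + e) *: 'X^n + (n%:R * c) *: 'X^(n.-1).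
  rewrite derivXn /phi /psi -!mul_polyC -mulr_natr.
  case: n => [|n] /=; rewrite !rmorphD !rmorphM /= !polyC_natr.
    by rewrite expr0 expr1; ring.
  by rewrite !exprS; ring.
rewrite !linearD /= !momentZ !momentXn.
by case: n => [|n] //=; rewrite !mul0r.
Qed.

(** The recurrence is the Pearson equation on monomials. *)
Lemma pearsonP :
  pearson <-> forall n : nat,
    (n%:R * a + d) * mu n.+1 + (n%:R * b + e) * mu n
      + n%:R * c * Defs.prev mu n = 0.
Proof.
split=> [hP n|hrec p]; first by rewrite -pearson_monomial hP.
pose f : {poly R} -> {poly R} := fun q => phi * q^`() + psi * q.
have f_lin : linear f.
  move=> x q r; rewrite /f derivD derivZ scalerDr !scalerAr !mulrDr.
  by rewrite addrACA.
pose F := GRing.isLinear.Build R _ _ _ f f_lin.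
pose g : {linear {poly R} -> {poly R}} := HB.pack f F.
by apply: (@moment_eq_on_monomials g) => n; rewrite /= /f pearson_monomial hrec.
Qed.

Lemma sigma_moment (k n : nat) : sigma a b c mu k n = L (phi ^+ k * 'X^n).
Proof.
elim: k n => [|k IHk] n /=; first by rewrite mul1r momentXn.
rewrite !IHk -!momentZ -!linearD /=; congr (L _).
by rewrite /phi -!mul_polyC !exprS; ring.
Qed.

(** The polynomial [T] such that [D^r (q phi^r u) = T u] under the Pearson
    equation: one differentiation turns [q phi^(r+1) u] into
    [(phi q' + (psi + r phi') q) phi^r u]. *)
Fixpoint rodrigues (r : nat) (q : {poly R}) : {poly R} :=
  if r is r'.+1 then
    rodrigues r' (phi * q^`() + (psi + r'%:R *: phi^`()) * q)
  else q.

Lemma rodriguesE (r : nat) (q p : {poly R}) : pearson ->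
  L (phi ^+ r * q * p^`(r)) = (-1) ^+ r * L (rodrigues r q * p).
Proof.
move=> hP; elim: r q => [|r IHr] q; first by rewrite !mul1r derivn0.
rewrite /= [(-1) ^+ _]exprS -[RHS]mulrA -IHr mulN1r.
apply/eqP; rewrite -addr_eq0; apply/eqP.
rewrite -linearD /= -[RHS](hP (phi ^+ r * q * p^`(r))); congr (L _).
rewrite !derivM deriv_exp -derivnS -scaler_nat -!mul_polyC polyC_natr.
rewrite -mulr_natr.
by case: r {IHr} => [|r]; rewrite ?expr0 /= ?exprS; ring.
Qed.

Lemma rodrigues_step_coef (r j : nat) (q : {poly R}) :
  (phi * q^`() + (psi + r%:R *: phi^`()) * q)`_j.+1
  = ((j + r.*2)%:R * a + d) * q`_j + ((j.+1 + r)%:R * b + e) * q`_j.+1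
    + j.+2%:R * c * q`_j.+2.
Proof.
have dphi : phi^`() = (a *+ 2) *: 'X + b%:P.
  rewrite /phi !derivD derivC !derivZ derivX derivXn /= addr0 alg_polyC.
  by rewrite -scalerMnr scalerMnl.
have -> : phi * q^`() + (psi + r%:R *: phi^`()) * q
    = a *: ('X * ('X * q^`())) + b *: ('X * q^`()) + c *: q^`()
      + (d + r.*2%:R * a) *: ('X * q) + (e + r%:R * b) *: q.
  rewrite dphi /phi /psi -!mul_polyC !rmorphD !rmorphM /= -addnn natrD.
  by rewrite -mulr_natr !rmorphM !rmorphD /= expr2; ring.
rewrite !coefD !coefZ !coefXM /= !coef_deriv.
by case: j => [|j] /=; rewrite -addnn; ring.
Qed.

(** The coefficient of degree [m + r] of [rodrigues r q], for [q] of degree at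
    most [m]: each step raises this degree by one and contributes one factor. *)
Lemma rodrigues_coef (r m : nat) (q : {poly R}) : (size q <= m.+1)%N ->
  (size (rodrigues r q) <= (m + r).+1)%N /\
  (rodrigues r q)`_(m + r)
    = q`_m * \prod_(i < r) ((m + r + r.-1 - i.+1)%:R * a + d).
Proof.
elim: r m q => [|r IHr] m q sq; first by rewrite addn0 big_ord0 mulr1.
have q0 j : (m < j)%N -> q`_j = 0.
  by move=> ltmj; rewrite nth_default ?(leq_trans sq).
rewrite /= -addSnnS.
set q1 := (X in rodrigues r X).
have sq1 : (size q1 <= m.+2)%N.
  apply/leq_sizeP => -[//|j] ltmj.
  by rewrite rodrigues_step_coef !q0 ?mulr0 ?addr0 //; lia.
have [sT ->] := IHr m.+1 q1 sq1; split=> //.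
rewrite rodrigues_step_coef (q0 m.+1) // (q0 m.+2) // !mulr0 !addr0.
rewrite big_ord_recl [LHS]mulrAC mulrC; congr (_ * (_ * _)).
  by congr (_%:R * a + d); rewrite /=; lia.
apply: eq_bigr => i _; congr (_%:R * a + d); have := ltn_ord i.
by rewrite /= /bump /=; lia.
Qed.

(** The coefficient of degree [k] of [rodrigues k 1]: the factors are [i a + d]
    for [k - 1 <= i <= 2 k - 2]. *)
Definition rodrigues_lead (k : nat) : R :=
  \prod_(i < k) ((k + k.-1 - i.+1)%:R * a + d).

(** The Rodrigues formula [D^k(phi^k u) = Q_k u], with [Q_k] written as
    a multiple of [P_k]. *)
Lemma rodrigues_formula (k j : nat) (p : {poly R}) :
  (forall n : nat, \det (hankel mu n) != 0) ->
  pearson -> monic_orthogonal k p ->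
  L (phi ^+ k * ('X^j)^`(k)) = (-1) ^+ k * rodrigues_lead k * L (p * 'X^j).
Proof.
move=> hdet hP hp.
have [|sQ cQ] := @rodrigues_coef k 0 1; first by rewrite size_poly1.
have oQ i : (i < k)%N -> L (rodrigues k 1 * 'X^i) = 0.
  move=> lt_ik; have := rodriguesE k 1 'X^i hP.
  rewrite derivn_poly0 ?size_polyXn // mulr0 linear0 => /esym/eqP.
  by rewrite mulf_eq0 signr_eq0 => /eqP.
rewrite -[phi ^+ k]mulr1 rodriguesE // (orthogonal_scale hdet hp sQ oQ) cQ.
by rewrite coef1 mul1r -scalerAl momentZ mulrA.
Qed.

End Pearson.

(** * The Cholesky factor *)

Lemma invmx_unit_lower (n : nat) (A : 'M[R]_n) :
  unit_lower_triangular A -> A \in unitmx /\ is_trig_mx (invmx A).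
Proof.
move=> [trA diagA].
have uA : A \in unitmx.
  by rewrite unitmxE det_trig // big1 ?unitr1 // => i _; rewrite diagA.
split=> //; apply/is_trig_mxP => i j.
have [m] := ubnP i; elim: m i => // m IHm i /ltnSE le_im lt_ij.
have := congr1 (fun B : 'M_n => B i j) (mulmxV uA).
rewrite !mxE (bigD1 i) //= diagA mul1r [RHS]mulrb ifN ?neq_ltn ?lt_ij //.
rewrite big1 ?addr0 // => l; rewrite neq_ltn => /orP[lt_li|lt_il].
  rewrite (IHm l) ?mulr0 //; first exact: leq_trans lt_li le_im.
  exact: ltn_trans lt_li lt_ij.
by rewrite (is_trig_mxP trA) ?mul0r.
Qed.

(** The polynomial whose coefficients are listed by row [k] of the matrix. *)
Definition row_poly (n : nat) (A : 'M[R]_n.+1) (k : nat) : {poly R} :=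
  rVpoly (row (inord k) A).

Lemma row_poly_coef (n : nat) (A : 'M[R]_n.+1) (k : nat) (i : 'I_n.+1) :
  (row_poly A k)`_i = A (inord k) i.
Proof. by rewrite coef_rVpoly_ord mxE. Qed.

Lemma hankel_mul_col (n : nat) (A : 'M[R]_n.+1) (k : nat) :
  hankel mu n *m col (inord k) A^T = \col_j L (row_poly A k * 'X^j).
Proof.
apply/colP => j; rewrite !mxE (@moment_mulXn _ n.+1) ?size_poly //.
by apply: eq_bigr => i _; rewrite !mxE row_poly_coef mulrC.
Qed.

(** From [A G = D A^-T] with [A^-T] upper triangular: row [k] of [A G] vanishes
    to the left of the diagonal. *)
Lemma chol_poly_orthogonal (n : nat) (A D : 'M[R]_n.+1) (k : nat) :
  cholesky (hankel mu n) A D -> (k <= n)%N -> monic_orthogonal k (row_poly A k).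
Proof.
move=> [uA diagD _ hG] le_kn; have [trA diagA] := uA.
have [unitA trV] := invmx_unit_lower uA.
have kE : (inord k : 'I_n.+1) = k :> nat by rewrite inordK.
split.
- apply/leq_sizeP => j lt_kj; have [le_jn|lt_nj] := leqP j.+1 n.+1.
    rewrite (row_poly_coef A k (Ordinal le_jn)).
    by rewrite (is_trig_mxP trA) // kE.
  by rewrite nth_default // (leq_trans (size_poly _ _)).
- by rewrite -[X in _`_X]kE row_poly_coef diagA.
move=> j lt_jk; have lt_jn : (j < n.+1)%N by lia.
have AG : A *m hankel mu n = D *m (invmx A)^T.
  by rewrite hG !mulmxA mulmxV // mul1mx.
have := congr1 (fun B : 'M_n.+1 => B (inord k) (Ordinal lt_jn)) AG.
rewrite !mxE [X in _ = X]big1 => [<-|l _].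
  rewrite (@moment_mulXn _ n.+1) ?size_poly //.
  by apply: eq_bigr => i _; rewrite row_poly_coef !mxE addnC.
have [->|neq] := eqVneq l (inord k).
  by rewrite mxE (is_trig_mxP trV) ?mulr0 // kE.
by rewrite (is_diag_mxP diagD) ?mul0r // eq_sym.
Qed.

(** The first column of [A^T] is the first unit vector. *)
Lemma mul_col0_unit_lower (m n : nat) (B : 'M[R]_(m, n.+1)) (A : 'M[R]_n.+1) :
  unit_lower_triangular A -> B *m col ord0 A^T = col ord0 B.
Proof.
move=> [trA diagA]; apply/colP => i; rewrite !mxE big_ord_recl big1 => [|j _].
  by rewrite !mxE diagA mulr1 addr0.
by rewrite !mxE (is_trig_mxP trA) ?mulr0.
Qed.

(** The product of the [N^T] is [k]-fold differentiation of monomials. *)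
Lemma NTprod_mul_col (n k : nat) (w : nat -> R) :
  NTprod R n k *m (\col_i w i) = \col_j ((j ^_ k)%:R * w (j - k)%N).
Proof.
elim: k => [|k IHk] /=.
  by rewrite mul1mx; apply/colP => j; rewrite !mxE subn0 mul1r.
rewrite -mulmxA IHk; apply/colP => -[[|j] lt_j]; rewrite !mxE /=.
  by rewrite mul0r big1 // => i _; rewrite !mxE mul0r.
have lt_j' : (j < (k + n).+1)%N by [].
rewrite (bigD1 (Ordinal lt_j')) //= big1 => [|i].
  by rewrite !mxE /= eqxx addr0 mulrA -natrM.
rewrite -val_eqE /= => neq_ij.
by rewrite !mxE /= eqSS eq_sym (negbTE neq_ij) mul0r.
Qed.

(** The entries of the matrix identity are the Rodrigues formula on monomials. *)
Lemma matrix_identityP (a b c : R) (n k : nat) (A0 : 'M[R]_n.+1)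
    (A1 : 'M[R]_((k + n).+1)) (w : R) : unit_lower_triangular A0 ->
  NTprod R n k *m hankel (sigma a b c mu k) n *m col ord0 A0^T
    = w *: (hankel mu (k + n) *m col (inord k) A1^T)
  <-> forall j, (j <= k + n)%N ->
    L (phi a b c ^+ k * ('X^j)^`(k)) = w * L (row_poly A1 k * 'X^j).
Proof.
move=> uA0; rewrite -mulmxA mul_col0_unit_lower // hankel_mul_col.
have -> : col ord0 (hankel (sigma a b c mu k) n)
    = \col_i sigma a b c mu k i.
  by apply/colP => i; rewrite !mxE addn0.
rewrite NTprod_mul_col.
have entry j : (j ^_ k)%:R * sigma a b c mu k (j - k)
    = L (phi a b c ^+ k * ('X^j)^`(k)).
  by rewrite sigma_moment derivnXn -scaler_nat -scalerAr momentZ.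
split=> [/colP h j lt_j|h].
  by have := h (Ordinal (lt_j : (j < (k + n).+1)%N)); rewrite !mxE entry.
by apply/colP => j; rewrite !mxE entry h // -ltnS.
Qed.

End Moment.

(** * The characterization of classical sequences *)

Theorem theorem5p13 (R : realType) (mu : nat -> R)
    (S H : forall n : nat, 'M[R]_n.+1)
    (hdet : forall n : nat, \det (hankel mu n) != 0)
    (hchol : forall n : nat, cholesky (hankel mu n) (S n) (H n)) :
  classical mu <->
  exists a b c : R,
    0 < `|a| + `|b| + `|c| /\
    exists varpi : nat -> R,
      (forall k : nat, (1 <= k)%N -> varpi k != 0) /\
      (forall n k : nat, (1 <= n)%N -> (1 <= k <= n)%N ->
        NTprod R n k *m hankel (sigma a b c mu k) n *m col ord0 (S n)^T
        = varpi k *: (hankel mu (k + n) *m col (inord k) (S (k + n)%N)^T)).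
Proof.
have unitS n : unit_lower_triangular (S n) by case: (hchol n).
have orthS n k : (k <= n)%N -> monic_orthogonal mu k (row_poly (S n) k).
  exact: chol_poly_orthogonal (hchol n).
split=> [[[_ [a [b [c [d [e [abc_gt0 ad_neq0 /pearsonP hP]]]]]]] _]|].
  exists a, b, c; split=> //.
  exists (fun k => (-1) ^+ k * rodrigues_lead a d k); split=> [k _|n k _ _].
    rewrite mulf_neq0 ?signr_eq0 //.
    by apply/prodf_neq0 => i _; apply: ad_neq0.
  apply/matrix_identityP => // j _.
  rewrite (rodrigues_formula j hdet hP (orthS (k + n)%N k _)) //.
  exact: leq_addr.
move=> [a [b [c [abc_gt0 [w [w_neq0 hmx]]]]]].
have identity n k j : (1 <= n)%N -> (1 <= k <= n)%N -> (j <= k + n)%N ->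
    moment mu (phi a b c ^+ k * ('X^j)^`(k))
    = w k * moment mu (row_poly (S (k + n)) k * 'X^j).
  move=> n_gt0 kn.
  by apply: (matrix_identityP mu _ _ _ _ _ (unitS n)).1; apply: hmx.
set p1 := row_poly (S 1) 1.
have [sp1 p1_1 _] : monic_orthogonal mu 1 p1 by exact: orthS.
(* The identity for [k = 1] reads [D(phi u) = - varpi_1 P_1 u]. *)
pose d := - w 1%N; pose e := d * p1`_0.
have psiE : psi d e = d *: p1.
  apply/polyP => i; rewrite coefD !coefZ coefX coefC.
  case: i => [|[|i]] /=; first by rewrite mulr0 add0r.
    by rewrite p1_1 addr0.
  by rewrite [in RHS]nth_default ?(leq_trans sp1) // !mulr0 addr0.
have hP : pearson mu a b c d e.
  apply/pearsonP => j; rewrite -pearson_monomial psiE linearD /=.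
  have -> : p1 = row_poly (S (1 + j.+1)) 1.
    by apply: (monic_orthogonal_uniq hdet (k := 1)); apply: orthS.
  have := identity j.+1 1%N j isT isT; rewrite expr1 derivn1 => -> //.
    by rewrite -scalerAl momentZ -mulrDl subrr mul0r.
  by rewrite add1n; lia.
split=> //; split; first by have := hdet 0%N; rewrite det_mx11 mxE.
exists a, b, c, d, e; split=> // [n|]; last exact/pearsonP.
(* The factor [n a + d] is the last one in [rodrigues_lead a d n.+1]; the
   identity is tested on [X^(n+1)], where [<u, P_(n+1) X^(n+1)>] is nonzero. *)
have horth : monic_orthogonal mu n.+1 (row_poly (S (n.+1 + n.+1)) n.+1).
  by apply: orthS; rewrite leq_addr.
have := identity n.+1 n.+1 n.+1 isT; rewrite leqnn leq_addr => /(_ isT isT).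
rewrite (rodrigues_formula _ hdet hP horth).
move=> /(mulIf (monic_orthogonal_neq0 hdet horth)) lead_eq.
have := w_neq0 n.+1 isT; rewrite -lead_eq mulf_eq0 negb_or.
move=> /andP[_ /prodf_neq0 /(_ ord_max isT)] /=.
by have -> : (n.+1 + n - n.+1 = n)%N by lia.
Qed.
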